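(* Let $0<\varepsilon<\tfrac14$. In general, neither of $\approx_\varepsilon^b$ and $\approx_\varepsilon^w$ implies the other: there is an LMC with states $s,t$ such that $s\approx_\varepsilon^b t$ but $s\not\approx_\varepsilon^w t$, and there is an LMC with states $s,t$ such that $s\approx_\varepsilon^w t$ but $s\not\approx_\varepsilon^b t$.
   Context: Fix a countable set $AP$ of atomic propositions. A labeled Markov chain (LMC) $\mathcal{M}=(S,P,s_{init},l)$ has a countable nonempty state set $S$, a transition function $P\colon S\to Distr(S)$ ($Distr(S)$ is the set of probability distributions on $S$), an initial state $s_{init}\in S$ and a labeling $l\colon S\to 2^{AP}$. LMCs are assumed finitely branching: $\{t\mid P(s)(t)>0\}$ is finite for every $s$. $\mathrm{Pr}_s$ is the standard probability measure on infinite paths starting in $s$. For $B,C\subseteq S$, $\mathrm{Pr}_s(B\,\mathsf{U}\,C)$ is the probability that a path from $s$ eventually visits $C$ with all states before the first visit to $C$ lying in $B$ (so it is $1$ if $s\in C$). $L(s)=\{t\in S\mid l(t)=l(s)\}$. For $R\subseteq S\times S$ and $A\subseteq S$, $R(A)=\{t\mid\exists s\in A\colon(s,t)\in R\}$, and $A$ is $R$-closed if $R(A)\subseteq A$. An equivalence $R$ with classes $[s]_R$ is a branching $\varepsilon$-bisimulation if for all $(s,t)\in R$ and all $R$-closed $A\subseteq S$: $l(s)=l(t)$ and $|\mathrm{Pr}_s([s]_R\,\mathsf{U}\,A)-\mathrm{Pr}_t([t]_R\,\mathsf{U}\,A)|\le\varepsilon$. $s\approx_\varepsilon^b t$ if $(s,t)\in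 R$ for some branching $\varepsilon$-bisimulation $R$. A reflexive and symmetric $R$ is a weak $\varepsilon$-bisimulation if for all $(s,t)\in R$ and all $A\subseteq S$: $l(s)=l(t)$ and $\mathrm{Pr}_s(L(s)\,\mathsf{U}\,A)\le\mathrm{Pr}_t(L(t)\,\mathsf{U}\,R(A))+\varepsilon$. $s\approx_\varepsilon^w t$ if $(s,t)\in R$ for some weak $\varepsilon$-bisimulation $R$. *)

(* Defs.v *)
From HB Require Import structures.
From mathcomp Require Import all_boot all_order all_algebra.
From mathcomp Require Import all_classical all_reals all_analysis.
From mathcomp Require Import finmap.
From Stdlib Require Import RelationClasses.

Set Implicit Arguments.
Unset Strict Implicit.
Unset Printing Implicit Defensive.

Import Order.TTheory GRing.Theory Num.Theory.
Import numFieldNormedType.Exports.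

Local Open Scope classical_set_scope.
Local Open Scope ring_scope.

Record Distr (R : realType) (S : countType) := MkDistr {
  prob :> S -> R;
  prob_ge0 : forall t, 0 <= prob t;
  prob_sum1 : (\esum_(t in [set: S]) (prob t)%:E = 1)%E
}.

Record LMC (R : realType) (AP : countType) := MkLMC {
  state :> countType;
  trans : state -> Distr R state;
  init : state;
  label : state -> set AP;
  finitely_branching : forall s, finite_set [set t | 0 < trans s t]
}.

(* Alias of m carrying its probability instance. *)
Definition unit_mass (d : measure_display) (T : measurableType d) (R : realType)
  (m : {measure set T -> \bar R}) (m1 : m setT = 1%E) : set T -> \bar R := m.

Section UnitMass.
Context (d : measure_display) (T : measurableType d) (R : realType).
Variables (m : {measure set T -> \bar R}) (m1 : m setT = 1%E).

HB.instance Definition _ := Measure.copy (unit_mass m1) m.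
HB.instance Definition _ :=
  Measure_isProbability.Build d T R (unit_mass m1) m1.

End UnitMass.

Section PathMeasure.
Context {R : realType} {AP : countType} (M : LMC R AP).

(* Sequences using transitions of probability 0 are also included; they form a
   null set. *)
Definition inf_path : Type := nat -> M.

HB.instance Definition _ := gen_eqMixin inf_path.
HB.instance Definition _ := gen_choiceMixin inf_path.
HB.instance Definition _ := isPointed.Build inf_path (fun=> init M).

Definition cylinder (w : seq M) : set inf_path := [set p | mkseq p (size w) = w].

Definition measurable_path := g_sigma_algebraType (range cylinder).

Fixpoint word_prob (s : M) (w : seq M) : R :=
  if w is t :: w' then trans s t * word_prob t w' else 1.

(* The cylinders starting in s determine the measure: path_measure_exists and
   path_measure_unique below. *)
Definition is_path_measure (s : M) (mu : probability measurable_path R) : Prop :=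
  forall w, mu (cylinder (s :: w)) = (word_prob s w)%:E.

(* Existence of the path measure: refine a uniform u in [0, 1[ step by step
   into a path, so that the u whose path extends a given word form an interval
   whose length is the probability of that word. *)

Let supp (s : M) : seq M := enum_fset (fset_set [set t | 0 < trans s t]).

Let mem_supp s t : (t \in supp s) = (0 < trans s t).
Proof.
rewrite -[LHS]/(t \in fset_set _) in_fset_set; last exact: finitely_branching.
by apply/idP/idP => [/set_mem|tp]; last exact/mem_set.
Qed.

Let sum_supp s : \sum_(t <- supp s) trans s t = 1.
Proof.
apply: EFin_inj; rewrite -(prob_sum1 (trans s)) -sumEFin.
have fin := finitely_branching s.
rewrite /supp -(@fsbig_finite _ _ _ _ _ (fun t => (trans s t)%:E) fin).
rewrite -esum_fset //; last by move=> t _; rewrite lee_fin prob_ge0.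
rewrite esum_mkcond; apply: eq_esum => t _.
case: ifPn => // tn0; congr EFin; apply/eqP.
by rewrite eq_le prob_ge0 leNgt; apply: contra tn0 => /mem_set.
Qed.

Let pick (s : M) := fix pick (l : seq M) (u : R) : M * R :=
  if l is t :: l' then
    if u < trans s t then (t, u / trans s t) else pick l' (u - trans s t)
  else (s, 0).

Let off (s : M) := fix off (l : seq M) (t : M) : R :=
  if l is x :: l' then if x == t then 0 else trans s x + off l' t else 0.

Let off_ge0 s l t : 0 <= off s l t.
Proof.
elim: l => //= x l IH; case: eqP => // _.
by rewrite addr_ge0 ?prob_ge0.
Qed.

Let off_le s l t : t \in l -> off s l t + trans s t <= \sum_(x <- l) trans s x.
Proof.
elim: l => // x l IH; rewrite big_cons inE /= eq_sym.
case: (eqVneq x t) => [-> _|_ /= /IH]; last by rewrite -addrA lerD2l.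
by rewrite add0r lerDl sumr_ge0 // => i _; exact: prob_ge0.
Qed.

Let pickP s l u : uniq l -> 0 <= u < \sum_(x <- l) trans s x ->
  [/\ (pick s l u).1 \in l, 0 <= (pick s l u).2 < 1
    & u = off s l (pick s l u).1 + trans s (pick s l u).1 * (pick s l u).2].
Proof.
elim: l u => [|x l IH] u.
  by rewrite big_nil => _ /andP[] /le_lt_trans /[apply]; rewrite ltxx.
rewrite big_cons /= => /andP[xl ul] /andP[u0 us]; case: ltP => [ux|xu] /=.
  have x0 : 0 < trans s x by exact: le_lt_trans ux.
  rewrite eqxx mem_head add0r [trans s x * _]mulrC divfK ?gt_eqF // ltr_pdivrMr // mul1r ux.
  by rewrite divr_ge0 // ltW.
have /(IH _ ul) : 0 <= u - trans s x < \sum_(y <- l) trans s y.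
  by rewrite subr_ge0 xu ltrBlDl.
set y := pick s l _ => -[yl y2 uE].
rewrite inE yl orbT; split=> //.
case: eqP => [xy|_]; first by move: xl; rewrite xy yl.
by rewrite -addrA -uE addrC subrK.
Qed.

Let pick_off s l t v : 0 < trans s t -> t \in l -> 0 <= v < 1 ->
  pick s l (off s l t + trans s t * v) = (t, v).
Proof.
move=> t0; elim: l => // x l IH; rewrite inE /= eq_sym => tl v01.
have /andP[v0 v1] := v01.
case: (eqVneq x t) tl => [->|_] /= tl.
  by rewrite add0r gtr_pMr // v1 [trans s t * v]mulrC mulfK // gt_eqF.
rewrite ltNge -addrA lerDl addr_ge0 ?mulr_ge0 ?prob_ge0 //=.
by rewrite [X in pick s l X]addrC addKr IH.
Qed.

Let step s u := pick s (supp s) u.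

Let sample := fix sample (s : M) (u : R) (n : nat) : M :=
  if n is n'.+1 then sample (step s u).1 (step s u).2 n' else s.

Let low := fix low (s : M) (w : seq M) : R :=
  if w is t :: w' then off s (supp s) t + trans s t * low t w' else 0.

Let word_prob_ge0 s w : 0 <= word_prob s w.
Proof. by elim: w s => //= t w IH s; rewrite mulr_ge0 ?prob_ge0. Qed.

Let low_ge0 s w : 0 <= low s w.
Proof. by elim: w s => //= t w IH s; rewrite addr_ge0 // mulr_ge0 ?prob_ge0. Qed.

Let low_le1 s w : 0 < word_prob s w -> low s w + word_prob s w <= 1.
Proof.
elim: w s => /= [s|t w IH s]; first by rewrite add0r.
move=> p0; have t0 : 0 < trans s t.
  rewrite lt_neqAle prob_ge0 andbT eq_sym; apply/eqP => t0.
  by move: p0; rewrite t0 mul0r ltxx.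
move: p0; rewrite pmulr_rgt0 // => /IH h.
rewrite -addrA -mulrDr -(sum_supp s).
have /(@off_le s) : t \in supp s by rewrite mem_supp.
by apply: le_trans; rewrite lerD2l ger_pMr.
Qed.

Let sampleP s w u : 0 <= u < 1 ->
  (mkseq (sample s u) (size w).+1 == s :: w) =
  (low s w <= u < low s w + word_prob s w).
Proof.
elim: w s u => [|t w IH] s u u01.
  by rewrite /= eqxx add0r u01.
have [ts v01 uE] : [/\ (step s u).1 \in supp s, 0 <= (step s u).2 < 1 &
    u = off s (supp s) (step s u).1 + trans s (step s u).1 * (step s u).2].
  by apply: pickP; rewrite ?sum_supp //; exact: fset_uniq.
have -> n : mkseq (sample s u) n.+1 =
    s :: mkseq (sample (step s u).1 (step s u).2) n.
  by rewrite /mkseq /= (iotaDl 1 0 n) -map_comp.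
rewrite eqseq_cons eqxx /=.
have [tE|tN] := eqVneq (step s u).1 t.
  rewrite tE; have t0 : 0 < trans s t by rewrite -mem_supp -tE.
  rewrite -[X in X == _]/(mkseq (sample t (step s u).2) (size w).+1) IH //.
  rewrite [in RHS]uE tE lerD2l ler_pM2l // -[in RHS]addrA -mulrDr ltrD2l.
  by rewrite ltr_pM2l.
rewrite eqseq_cons (negPf tN) /=; apply/esym/negbTE/negP => /andP[lu ul].
have p0 : 0 < trans s t * word_prob t w.
  by have := le_lt_trans lu ul; rewrite ltrDl.
have t0 : 0 < trans s t.
  rewrite lt_neqAle prob_ge0 andbT eq_sym; apply/eqP => t0.
  by move: p0; rewrite t0 mul0r ltxx.
move: p0; rewrite pmulr_rgt0 // => w0.
pose v := (u - off s (supp s) t) / trans s t.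
have uE' : u = off s (supp s) t + trans s t * v.
  by rewrite mulrC divfK ?gt_eqF // addrC subrK.
have : 0 <= v < 1.
  move: lu ul; rewrite uE' -addrA -mulrDr lerD2l ltrD2l ler_pM2l // ltr_pM2l //.
  move=> lv vl; rewrite (le_trans (low_ge0 t w) lv) /=.
  exact: lt_le_trans vl (low_le1 w0).
move=> /(@pick_off s (supp s) _ _ t0); rewrite mem_supp -uE' => /(_ t0) stepE.
by move: tN; rewrite /step stepE eqxx.
Qed.

Let gen (s : M) (u : R) : measurable_path :=
  if 0 <= u < 1 then sample s u else fun=> s.

Let cylinder_nil : cylinder [::] = setT.
Proof. by apply/seteqP; split. Qed.

Let gen_head s u x w : cylinder (x :: w) (gen s u) -> x = s.
Proof. by rewrite /cylinder /= /gen; case: ifP => _ -[]. Qed.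

Let gen_cylinder s w :
  gen s @^-1` cylinder (s :: w) `&` `[0, 1[%classic =
  `[low s w, low s w + word_prob s w[%classic.
Proof.
apply/seteqP; split=> u /=; rewrite !in_itv /=.
  by case; rewrite /cylinder /gen /= => + u01; rewrite u01 -sampleP // => ->.
move=> uI; suff u01 : 0 <= u < 1.
  by split=> //; rewrite /cylinder /gen u01 /=; apply/eqP; rewrite -sampleP in uI.
have /andP[lu ul] := uI; rewrite (le_trans (low_ge0 s w) lu) /=.
apply: (lt_le_trans ul (low_le1 _)).
by have := le_lt_trans lu ul; rewrite ltrDl.
Qed.

Let measurable_gen s : measurable_fun setT (gen s : measurableTypeR R -> _).
Proof.
apply: (@measurability _ _ (measurableTypeR R) measurable_path setT (gen s)
  (range cylinder)) => // _ [_ [w _ <-] <-].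
rewrite setTI; case: w => [|x w].
  by rewrite cylinder_nil preimage_setT.
have [->|xs] := eqVneq x s; last first.
  rewrite (_ : _ @^-1` _ = set0) //; apply/seteqP; split=> // u /gen_head xE.
  by rewrite xE eqxx in xs.
rewrite -[X in measurable X](setUIDK _ `[0, 1[%classic) gen_cylinder.
apply: measurableU; first exact: measurable_itv.
have [hs|hs] := pselect (cylinder (s :: w) (fun=> s)).
  rewrite (_ : _ `\` _ = ~` `[0, 1[%classic).
    by apply: measurableC; exact: measurable_itv.
  apply/seteqP; split=> u /=; first by case.
  rewrite in_itv /= => u01; split=> //.
  by rewrite /gen; case: ifP u01.
rewrite (_ : _ `\` _ = set0) //; apply/seteqP; split=> u //= [].
by rewrite in_itv /gen /=; case: ifP.
Qed.

Let unit_measure : {measure set (measurableTypeR R) -> \bar R} :=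
  mrestr lebesgue_measure (measurable_itv `[0 : R, 1[).

Lemma path_measure_exists s : exists mu, is_path_measure s mu.
Proof.
have [nu nuE] : exists nu : {measure set measurable_path -> \bar R},
    forall A, nu A = lebesgue_measure (gen s @^-1` A `&` `[0, 1[%classic).
  by exists (measure_function_pushforward__canonical__measure_function_Measure
    unit_measure (@measurable_gen s)).
have nu1 : nu setT = 1%E.
  by rewrite nuE preimage_setT setTI lebesgue_measure_itv /= lte01 oppr0 adde0.
exists (unit_mass nu1) => w; rewrite /unit_mass nuE gen_cylinder.
rewrite lebesgue_measure_itv /= lte_fin ltrDl.
case: ltP => [_|w0]; first by rewrite -EFinB addrAC subrr add0r.
by congr EFin; apply/le_anti; rewrite w0 word_prob_ge0.
Qed.

Definition path_measure (s : M) : probability measurable_path R :=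
  projT1 (cid (path_measure_exists s)).

Lemma path_measureP s : is_path_measure s (path_measure s).
Proof. exact: projT2 (cid (path_measure_exists s)). Qed.

Lemma path_measure_unique s (mu nu : probability measurable_path R) :
  is_path_measure s mu -> is_path_measure s nu ->
  forall A, measurable A -> mu A = nu A.
Proof.
move=> muP nuP.
have notin_s (la : probability measurable_path R) x w :
    is_path_measure s la -> x != s -> la (cylinder (x :: w)) = 0%E.
  move=> laP xs; have mcyl v : measurable (cylinder v : set measurable_path).
    by apply: sub_sigma_algebra; exists v.
  have : (la (cylinder (x :: w) `|` cylinder [:: s]) <= 1)%E.
    by apply: probability_le1; exact: measurableU.
  rewrite measureU //; last first.
    apply/seteqP; split=> // p [] /= -[px _] [ps].
    by move: xs; rewrite -px ps eqxx.
  move: (laP [::]); rewrite /= => e1.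
  rewrite e1 -[leRHS]add0e leeD2rE // => le0.
  by apply/le_anti; rewrite le0 measure_ge0.
have cylI (w v : seq M) : (size w <= size v)%N ->
    cylinder w `&` cylinder v = cylinder v \/ cylinder w `&` cylinder v = set0.
  move=> wv; have [[p [pw pv]]|/nonemptyPn] := pselect (cylinder w `&` cylinder v !=set0);
    last by right.
  left; apply/seteqP; split=> q [] //= qv; split=> //.
  have take_mkseq (r : inf_path) : take (size w) (mkseq r (size v)) = mkseq r (size w).
    by rewrite -map_take take_iota (minn_idPl wv).
  by rewrite /cylinder /= -take_mkseq [mkseq q _]qv -pv take_mkseq.
pose C : set (set measurable_path) := range cylinder `|` [set set0].
have C_gen : measurable = <<s C >> :> set (set measurable_path).
  apply/seteqP; split; first by apply: sub_sigma_algebra2 => X cX; left.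
  apply: smallest_sub; first exact: smallest_sigma_algebra.
  move=> X [cX|->]; [exact: sub_sigma_algebra|exact: sigma_algebra0].
apply: (@measure_unique _ R measurable_path C (fun=> setT)) => //.
- move=> A B [[w _ <-]|->]; last by rewrite set0I; right.
  move=> [[v _ <-]|->]; last by rewrite setI0; right.
  wlog wv : w v / (size w <= size v)%N.
    by case: (leqP (size w) (size v)) => [|/ltnW] wv /(_ _ _ wv); rewrite // setIC.
  by case: (cylI w v wv) => ->; [left; exists v|right].
- by move=> _; left; exists [::].
- by apply/seteqP; split=> // p _; exists 0%N.
- move=> A [[w _ <-]|->]; last by rewrite !measure0.
  case: w => [|x w].
    have -> : cylinder [::] = setT :> set measurable_path by exact: cylinder_nil.
    by rewrite /= !probability_setT.
  have [->|xs] := eqVneq x s; first exact: etrans (muP w) (esym (nuP w)).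
  exact: etrans (notin_s _ _ w muP xs) (esym (notin_s _ _ w nuP xs)).
- by move=> k; rewrite /= probability_setT ltry.
Qed.

End PathMeasure.

Section Bisimulation.
Context {R : realType} {AP : countType} {M : LMC R AP}.
Implicit Types (s t : M) (A B C : set M) (Rel : M -> M -> Prop).

Definition until B C : set (inf_path M) :=
  [set p | exists n, C (p n) /\ forall i, (i < n)%N -> ~ C (p i) /\ B (p i)].

Definition Pr_until s B C : R := fine (path_measure s (until B C)).

Definition same_label s : set M := [set t | label t = label s].

Definition rel_image Rel A : set M := [set t | exists2 s, A s & Rel s t].

Definition rel_closed Rel A : Prop := rel_image Rel A `<=` A.

Definition eq_class Rel s : set M := [set t | Rel s t].

Definition branching_bisimulation (eps : R) Rel : Prop :=
  Equivalence Rel /\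
  forall s t A, Rel s t -> rel_closed Rel A ->
    label s = label t /\
    `|Pr_until s (eq_class Rel s) A - Pr_until t (eq_class Rel t) A| <= eps.

Definition branching_bisimilar (eps : R) s t : Prop :=
  exists Rel, branching_bisimulation eps Rel /\ Rel s t.

Definition weak_bisimulation (eps : R) Rel : Prop :=
  [/\ Reflexive Rel, Symmetric Rel &
  forall s t A, Rel s t ->
    label s = label t /\
    Pr_until s (same_label s) A
      <= Pr_until t (same_label t) (rel_image Rel A) + eps].

Definition weak_bisimilar (eps : R) s t : Prop :=
  exists Rel, weak_bisimulation eps Rel /\ Rel s t.

End Bisimulation.

(* Main.v *)
Require Import Defs.
From HB Require Import structures.
From mathcomp Require Import all_boot all_order all_algebra.
From mathcomp Require Import all_classical all_reals all_analysis.
From mathcomp Require Import ring lra.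

(* Weak bisimulation accumulates errors along equally labeled states, whereas
   branching bisimulation only compares what happens until the current class is
   left. In [chain1], [b1] alone is black; [s1] reaches it surely through [u1],
   while [t1] reaches it through [v1], each of the two steps failing (into the
   white sink [z1]) with probability eps. Leaving a class costs at most eps, but
   the probabilities of reaching [b1] along white states are 1 and
   (1 - eps)^2 < 1 - eps.

   Conversely, weak bisimulations need not be transitive. In [chain2], the white
   states [x2], [y2], [z2] reach black with probability 2 eps, eps and 0, so the
   outer two are weakly related to [y2] but no branching bisimulation relates
   them to each other. The black state [s2] moves to [x2] or [z2] with
   probability 1/2 each, and [t2] moves to [y2]: a branching bisimulation
   relating [s2] and [t2] would have to put [x2] and [z2] into the class of
   [y2]. *)

Set Implicit Arguments.
Unset Strict Implicit.
Unset Printing Implicit Defensive.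

Import Order.TTheory GRing.Theory Num.Theory.

Local Open Scope classical_set_scope.
Local Open Scope ring_scope.

Lemma mkseq_const (T : Type) (x : T) n : mkseq (fun=> x) n = nseq n x.
Proof. by rewrite /mkseq; elim: n 0%N => //= n IH k; rewrite IH. Qed.

(** * Until events: measurability, monotonicity, first steps and sinks *)

Section UntilProbability.
Context {R : realType} {AP : countType} {M : LMC R AP}.
Implicit Types (s t : M) (B C : set M).

Lemma measurable_cylinder (w : seq M) :
  measurable (cylinder w : set (measurable_path M)).
Proof. by apply: sub_sigma_algebra; exists w. Qed.

(** A finite prefix witnesses membership, so the event is the union of the cylinders it contains,
    and there are only countably many words. *)
Lemma measurable_until B C : measurable (until B C : set (measurable_path M)).
Proof.
pose F w : set (measurable_path M) :=
  [set p | cylinder w p /\ cylinder w `<=` until B C].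
have -> : until B C = \bigcup_(w : seq M) F w.
  apply/seteqP; split=> [p [n [Cn hn]]|p [w _ []] pw /(_ _ pw) //].
  (* Length [n.+1], so that the prefix includes the visit to [C] at index [n]. *)
  exists (mkseq p n.+1) => //; split; first by rewrite /cylinder /= size_map size_iota.
  move=> q; rewrite /cylinder /= size_map size_iota => qp.
  have qpE i : (i <= n)%N -> q i = p i.
    by move=> lin; rewrite -(nth_mkseq (init M) q (n := n.+1)) // qp nth_mkseq.
  exists n; split; first by rewrite qpE.
  by move=> i lin; rewrite qpE ?(ltnW lin) //; exact: hn.
apply: countable_bigcupT_measurable => // w.
have [wU|wU] := pselect (cylinder w `<=` until B C).
  rewrite (_ : F w = cylinder w); first exact: measurable_cylinder.
  by apply/seteqP; split=> p // [].
rewrite (_ : F w = set0); first exact: measurable0.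
by apply/seteqP; split=> p // [].
Qed.

Lemma Pr_untilE s B C : (Pr_until s B C)%:E = path_measure s (until B C).
Proof. by rewrite fineK // fin_num_measure //; exact: measurable_until. Qed.

(** The first visit to [C'] comes no later than the first visit to [C], so the states before it are
    still in [B]. *)
Lemma until_monotone B C C' : C `<=` C' -> until B C `<=` until B C'.
Proof.
move=> CC' p [n [Cn hn]].
have ex : exists n, `[< C' (p n) >] by exists n; exact/asboolP/CC'.
case: (ex_minnP ex) => m /asboolP Cm minm; exists m; split=> // i im; split.
  by move=> /asboolP /minm; rewrite leqNgt im.
have mn : (m <= n)%N by apply: minm; exact/asboolP/CC'.
by have [] := hn i (leq_trans im mn).
Qed.

Lemma Pr_until_monotone s B C C' : C `<=` C' -> Pr_until s B C <= Pr_until s B C'.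
Proof.
move=> CC'; rewrite -lee_fin !Pr_untilE.
by apply: le_measure; rewrite ?inE;
  [exact: measurable_until|exact: measurable_until|exact: until_monotone].
Qed.

(** Paths starting elsewhere lie in the complement of the cylinder of [[:: s]], which has mass 1. *)
Lemma path_measure_cylinder_neq s t w :
  t != s -> path_measure s (cylinder (t :: w)) = 0%E.
Proof.
move=> ts; have : (path_measure s (~` cylinder [:: s] : set (measurable_path M)) = 0)%E.
  rewrite probability_setC; last exact: measurable_cylinder.
  by rewrite (path_measureP s [::]) subee.
apply: subset_measure0; rewrite ?inE.
- exact: measurable_cylinder.
- by apply: measurableC; exact: measurable_cylinder.
by move=> p /= [pt _] [ps]; rewrite -pt ps eqxx in ts.
Qed.

Definition path_cons s (p : measurable_path M) : measurable_path M :=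
  fun n => if n is k.+1 then p k else s.

Lemma mkseq_path_cons s p n :
  mkseq (path_cons s p) n.+1 = s :: mkseq (p : nat -> M) n.
Proof. by rewrite /mkseq /= (iotaDl 1 0 n) -map_comp. Qed.

Lemma path_cons_cylinder s w :
  path_cons s @^-1` cylinder (s :: w) = cylinder w.
Proof.
apply/seteqP; split=> p; rewrite /cylinder /= -/(mkseq _ (size w).+1).
  by rewrite mkseq_path_cons => -[].
by rewrite mkseq_path_cons => ->.
Qed.

Lemma measurable_path_cons s : measurable_fun setT (path_cons s).
Proof.
apply: (@measurability _ _ (measurable_path M) (measurable_path M) setT (path_cons s)
  (range (@cylinder R AP M))) => //.
move=> _ [_ [w _ <-] <-]; rewrite setTI; case: w => [|t w].
  rewrite (_ : cylinder [::] = setT) ?preimage_setT //.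
  by apply/seteqP; split.
have [->|ts] := eqVneq t s.
  by rewrite path_cons_cylinder; exact: measurable_cylinder.
rewrite (_ : _ @^-1` _ = set0) //; apply/seteqP; split=> // p /= [st _].
by rewrite st eqxx in ts.
Qed.

Section TwoPointStep.
Variables (s x y : M) (p : R).
Hypothesis p01 : 0 <= p <= 1.
Hypothesis transE :
  forall t, trans s t = p * (x == t)%:R + (1 - p) * (y == t)%:R.

(** The right-hand side is a probability measure, a mixture of two pushforwards along [path_cons s].
    It has the right values on the cylinders starting in [s], so uniqueness applies. *)
Lemma path_measure_step (A : set (measurable_path M)) : measurable A ->
  path_measure s A = (p%:E * path_measure x (path_cons s @^-1` A) +
    (1 - p)%:E * path_measure y (path_cons s @^-1` A))%E.
Proof.
have /andP[p0] := p01; rewrite -subr_ge0 => q0 mA.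
pose push t : {measure set (measurable_path M) -> \bar R} :=
  measure_function_pushforward__canonical__measure_function_Measure
    (path_measure t) (measurable_path_cons s).
have [nu nuE] : exists nu : {measure set (measurable_path M) -> \bar R},
    forall D, nu D = (p%:E * path_measure x (path_cons s @^-1` D) +
      (1 - p)%:E * path_measure y (path_cons s @^-1` D))%E.
  exists (measure_add (mscale (NngNum p0) (push x)) (mscale (NngNum q0) (push y))).
  exact: measure_addE.
have nu1 : nu setT = 1%E.
  by rewrite nuE !preimage_setT !probability_setT !mule1 -EFinD addrC subrK.
rewrite -nuE; apply: (path_measure_unique (path_measureP s) _ mA (nu := unit_mass nu1)).
move=> w; rewrite /unit_mass nuE path_cons_cylinder; case: w => [|t w].
  rewrite /= (_ : cylinder [::] = setT); last by apply/seteqP; split.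
  by rewrite !probability_setT !mule1 -EFinD addrC subrK.
have mE z : path_measure z (cylinder (t :: w)) = ((z == t)%:R * word_prob t w)%:E.
  have [<-|zt] := eqVneq z t; first by rewrite mul1r; exact: path_measureP.
  by rewrite mul0r; apply: path_measure_cylinder_neq; rewrite eq_sym.
by rewrite !mE -!EFinM -EFinD /= transE; congr EFin; ring.
Qed.

(** First-step analysis: the preimage of the event under [path_cons s] is everything if [s] is in
    [C], the event itself if [s] is only in [B], and empty otherwise. *)
Lemma Pr_until_step B C : Pr_until s B C =
  if `[< C s >] then 1 else
  if `[< B s >] then p * Pr_until x B C + (1 - p) * Pr_until y B C else 0.
Proof.
apply: EFin_inj; rewrite Pr_untilE path_measure_step; last exact: measurable_until.
case: asboolP => [Cs|nCs].
  rewrite (_ : _ @^-1` _ = setT); last first.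
    by apply/seteqP; split=> // q _; exists 0%N.
  by rewrite !probability_setT !mule1 -EFinD addrC subrK.
case: asboolP => [Bs|nBs].
  rewrite (_ : _ @^-1` _ = until B C) ?EFinD ?EFinM ?Pr_untilE //.
  apply/seteqP; split=> q.
    by move=> [[|n] [// Cn hn]]; exists n; split=> // i /(hn i.+1).
  by move=> [n [Cn hn]]; exists n.+1; split=> // -[_|i /hn].
rewrite (_ : _ @^-1` _ = set0) ?measure0 ?mule0 ?adde0 //.
by apply/seteqP; split=> // q [[|n] [// _ /(_ 0%N isT) []]].
Qed.

End TwoPointStep.

Lemma Pr_until_sink s B C : (forall t, trans s t = (s == t)%:R) ->
  Pr_until s B C = (`[< C s >])%:R.
Proof.
move=> transE.
(* The Dirac mass at the constant path is the path measure of a sink. *)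
pose d : measurable_path M := fun=> s.
have dP : is_path_measure s (dirac d : probability (measurable_path M) R).
  move=> w; rewrite /= diracE; congr EFin.
  rewrite (_ : (d \in cylinder (s :: w)) = (nseq (size w) s == w)); last first.
    have dw : cylinder (s :: w) d <-> nseq (size w) s = w.
      rewrite -[cylinder _ _]/(mkseq (fun=> s) (size w).+1 = s :: w) mkseq_const.
      by split=> [[]|{2}<-].
    by apply/idP/eqP => [dC|wE]; [exact/dw/set_mem|exact/mem_set/dw].
  elim: w => //= t w IH; rewrite transE eqseq_cons.
  by have [<-|st] := eqVneq s t; rewrite ?mul0r // mul1r.
apply: EFin_inj; rewrite Pr_untilE.
rewrite (path_measure_unique (path_measureP s) dP (measurable_until B C)) /= diracE.
congr ((nat_of_bool _)%:R%:E); apply/idP/asboolP => [/set_mem [n [Cn _]] //|Cs].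
by apply/mem_set; exists 0%N.
Qed.

End UntilProbability.

(** * Distributions on at most two points *)

Section TwoPointChain.
Context {R : realType} {S : countType} (x y : S) (p : R).
Hypothesis p01 : 0 <= p <= 1.

(** As a sum of weighted indicators this also covers [x = y], the Dirac mass used for deterministic
    moves. *)
Let two_point_prob t : R := p * (x == t)%:R + (1 - p) * (y == t)%:R.

Lemma two_point_ge0 t : 0 <= two_point_prob t.
Proof.
by have /andP[p0] := p01; rewrite -subr_ge0 => q0; rewrite addr_ge0 // mulr_ge0.
Qed.

Lemma two_point_sum1 : (\esum_(t in [set: S]) (two_point_prob t)%:E = 1)%E.
Proof.
have /andP[p0] := p01; rewrite -subr_ge0 => q0.
have single z (a : R) : 0 <= a ->
    (\esum_(t in [set: S]) (a * (z == t)%:R)%:E = a%:E)%E.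
  move=> a0; rewrite -(@esum_set1 R S z (fun=> a%:E)) ?lee_fin // [RHS]esum_mkcond.
  apply: eq_esum => t _.
  by have [<-|/eqP zt] := eqVneq z t; [rewrite mulr1 mem_set|rewrite mulr0 memNset// => /esym].
under eq_esum do rewrite EFinD.
rewrite esumD; last 2 first.
- by move=> t _; rewrite lee_fin mulr_ge0.
- by move=> t _; rewrite lee_fin mulr_ge0.
by rewrite !single // -EFinD addrC subrK.
Qed.

Definition two_point : Distr R S := MkDistr two_point_ge0 two_point_sum1.

Lemma two_point_support : finite_set [set t | 0 < two_point t].
Proof.
apply: (@sub_finite_set _ _ [set x; y]); last exact: finite_set2.
move=> t /=; rewrite /two_point_prob.
have [->|_] := eqVneq x t; first by left.
by have [->|_] := eqVneq y t; [right|rewrite !mulr0 addr0 ltxx].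
Qed.

End TwoPointChain.

(** * Chains with two successors per state and two labels *)

Section TwoColourChain.
Context {R : realType} {AP : countType} {S : countType}.
Variables (x y : S -> S) (p : S -> R) (p01 : forall s, 0 <= p s <= 1).
Variables (s0 : S) (black : pred S).

(** Black states carry all atomic propositions and white states none; any single proposition tells
    them apart. *)
Definition two_colour_chain : LMC R AP :=
  @MkLMC R AP S (fun s => two_point (x s) (y s) (p01 s)) s0
    (fun s => [set _ | black s]) (fun s => two_point_support (x s) (y s) (p01 s)).

Implicit Types B C : set two_colour_chain.

Lemma chain_until_step (s : two_colour_chain) B C : Pr_until s B C =
  if `[< C s >] then 1 else if `[< B s >]
  then p s * Pr_until (x s : two_colour_chain) B C
       + (1 - p s) * Pr_until (y s : two_colour_chain) B C
  else 0.
Proof. exact: Pr_until_step. Qed.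

(** At a sink in [B] but not in [C], [chain_until_step] only equates the probability with itself, so
    the value needs a separate argument. *)
Lemma chain_until_sink (s : two_colour_chain) B C :
  x s = s -> y s = s -> Pr_until s B C = (`[< C s >])%:R.
Proof.
move=> xs ys; apply: Pr_until_sink => t.
by rewrite /= xs ys -mulrDl addrC subrK mul1r.
Qed.

Lemma chain_label (AP_nonempty : [set: AP] !=set0) (s t : two_colour_chain) :
  (label s = label t) <-> (black s = black t).
Proof.
have [a _] := AP_nonempty; split=> [lst|bst]; last by rewrite /= bst.
apply/idP/idP => [bs|bt].
  by have : label t a by rewrite -lst.
by have : label s a by rewrite lst.
Qed.

Lemma chain_same_label (AP_nonempty : [set: AP] !=set0)
    (s t : two_colour_chain) : `[< same_label s t >] = (black s == black t).
Proof.
apply/asboolP/eqP => [/(chain_label AP_nonempty)|] //.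
by move=> bst; apply/(chain_label AP_nonempty).
Qed.

End TwoColourChain.

(** * Branching bisimilar but not weakly bisimilar states *)

Section BranchingNotWeak.
Context {R : realType} {AP : countType} (AP_nonempty : [set: AP] !=set0).
Variables (eps : R) (eps_gt0 : 0 < eps) (eps_lt1 : eps < 1).

Inductive state1 := s1 | t1 | u1 | v1 | z1 | b1.

Definition code1 s : nat :=
  match s with s1 => 0 | t1 => 1 | u1 => 2 | v1 => 3 | z1 => 4 | b1 => 5 end.
Definition decode1 n :=
  match n with 0 => s1 | 1 => t1 | 2 => u1 | 3 => v1 | 4 => z1 | _ => b1 end.

Lemma code1K : cancel code1 decode1. Proof. by case. Qed.

HB.instance Definition _ := Countable.copy state1 (can_type code1K).

(** [main1] is taken with probability [prob1], [side1] with the rest. They differ only at the two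
    failing states [t1] and [v1]. *)
Definition main1 s :=
  match s with s1 => u1 | t1 => v1 | u1 => b1 | v1 => b1 | z1 => z1 | b1 => b1 end.
Definition side1 s := match s with t1 => z1 | v1 => z1 | s => main1 s end.
Definition prob1 s : R := match s with t1 | v1 => 1 - eps | _ => 1 end.
Definition black1 s := if s is b1 then true else false.

Lemma prob1_01 s : 0 <= prob1 s <= 1.
Proof.
have e0 := eps_gt0; have e1 := eps_lt1.
by case: s; apply/andP; split=> /=; lra.
Qed.

Definition chain1 : LMC R AP := two_colour_chain main1 side1 prob1_01 s1 black1.

Let stepE (s : chain1) B C := chain_until_step s B C.

Let sinkE (s : chain1) B C :=
  @chain_until_sink _ _ _ _ _ _ _ _ _ s B C.

Definition class1 s : nat :=
  match s with s1 | t1 => 0 | u1 | v1 => 1 | z1 => 2 | b1 => 3 end.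

(** Every move out of the classes of [s1] and [u1] leaves the class at once. Since a closed set is a
    union of classes, related states differ only by the step of probability [eps] into [z1]. *)
Lemma chain1_branching_bisimilar : branching_bisimilar eps (s1 : chain1) t1.
Proof.
pose Rel (s t : chain1) := class1 s = class1 t.
have classE (s t : chain1) : `[< eq_class Rel s t >] = (class1 s == class1 t).
  by apply/asboolP/eqP.
have close (s t : chain1) A : Rel s t -> rel_closed Rel A ->
    `[< A s >] = `[< A t >].
  move=> st Acl; apply/asboolP/asboolP => As; apply: Acl; first by exists s.
  by exists t.
have e0 := eps_gt0; have e1 := eps_lt1; exists Rel; split=> //; split.
  by split=> [s|s t|s t u]; rewrite /Rel // => -> .
move=> s t A st Acl; split.
  apply/(chain_label AP_nonempty); by case: s st; case: t.
have st_le : `|Pr_until (s1 : chain1) (eq_class Rel s1) A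
    - Pr_until (t1 : chain1) (eq_class Rel t1) A| <= eps.
  rewrite !(@stepE s1) !(@stepE t1) !(@stepE u1) !(@stepE v1) !(@sinkE z1) // !classE /= (close s1 t1) // (close u1 v1) //.
  case: `[< A t1 >]; case: `[< A v1 >]; case: `[< A z1 >] => /=;
    by rewrite ler_norml; apply/andP; split; lra.
have uv_le : `|Pr_until (u1 : chain1) (eq_class Rel u1) A
    - Pr_until (v1 : chain1) (eq_class Rel v1) A| <= eps.
  rewrite !(@stepE u1) !(@stepE v1) !(@sinkE z1) // !(@sinkE b1) // !classE /= (close u1 v1) //.
  case: `[< A v1 >]; case: `[< A z1 >]; case: `[< A b1 >] => /=;
    by rewrite ler_norml; apply/andP; split; lra.
case: s t st => -[] // _; rewrite ?subrr ?normr0 ?(ltW eps_gt0) //.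
  by rewrite distrC.
by rewrite distrC.
Qed.

Lemma chain1_not_weak_bisimilar : ~ weak_bisimilar eps (s1 : chain1) t1.
Proof.
move=> [Rel [[_ _ bis] st]].
(* Labels force every state related to [b1] to be black, hence to be [b1]. *)
have img : rel_image Rel [set (b1 : chain1)] `<=` [set (b1 : chain1)].
  move=> x [_ -> bx]; have [/(chain_label AP_nonempty) + _] := bis _ _ setT bx.
  by case: x {bx}.
have [_ /le_trans] := bis s1 t1 [set (b1 : chain1)] st.
have := @Pr_until_monotone _ _ _ (t1 : chain1) (same_label (t1 : chain1)) _ _ img.
rewrite -(lerD2r eps) => le_t /(_ _ le_t).
have inE (x : chain1) : `[< [set (b1 : chain1)] x >] = black1 x.
  by apply/asboolP/idP; case: x.
rewrite !(@stepE s1) !(@stepE t1) !(@stepE u1) !(@stepE v1) !(@sinkE z1) // !(@sinkE b1) //.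
rewrite !inE !chain_same_label //=.
(* What remains is [1 <= (1 - eps)^2 + eps], that is [eps * (1 - eps) <= 0]. *)
have e0 := eps_gt0; have e1 := eps_lt1; nra.
Qed.

End BranchingNotWeak.

(** * Weakly bisimilar but not branching bisimilar states *)

Section WeakNotBranching.
Context {R : realType} {AP : countType} (AP_nonempty : [set: AP] !=set0).
Variables (eps : R) (eps_gt0 : 0 < eps) (eps_lt : eps < 1 / 2).

Inductive state2 := s2 | t2 | x2 | y2 | z2.

Definition code2 s : nat :=
  match s with s2 => 0 | t2 => 1 | x2 => 2 | y2 => 3 | z2 => 4 end.
Definition decode2 n :=
  match n with 0 => s2 | 1 => t2 | 2 => x2 | 3 => y2 | _ => z2 end.

Lemma code2K : cancel code2 decode2. Proof. by case. Qed.

HB.instance Definition _ := Countable.copy state2 (can_type code2K).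

Definition main2 s :=
  match s with s2 => x2 | t2 => y2 | x2 => t2 | y2 => t2 | z2 => z2 end.
Definition side2 s := if s is t2 then y2 else z2.
Definition prob2 s : R :=
  match s with s2 => 1 / 2 | t2 => 1 | x2 => 2 * eps | y2 => eps | z2 => 1 end.
Definition black2 s := match s with s2 | t2 => true | _ => false end.

Lemma prob2_01 s : 0 <= prob2 s <= 1.
Proof.
have e0 := eps_gt0; have e1 := eps_lt.
by case: s; apply/andP; split=> /=; lra.
Qed.

Definition chain2 : LMC R AP := two_colour_chain main2 side2 prob2_01 s2 black2.

Let stepE (s : chain2) B C := chain_until_step s B C.

Let sinkE B C :=
  @chain_until_sink _ _ _ _ _ _ _ _ _ (z2 : chain2) B C erefl erefl.

Definition near2 (s t : chain2) : bool :=
  match s, t with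
  | s2, t2 | t2, s2 | x2, y2 | y2, x2 | y2, z2 | z2, y2 => true
  | s2, s2 | t2, t2 | x2, x2 | y2, y2 | z2, z2 => true
  | _, _ => false
  end.

Ltac case_asbool :=
  repeat match goal with |- context [asbool ?P] => case: (asbool P) => //= end.

(** [s2] and [t2] match without error because [y2] is near both [x2] and [z2]; the error [eps] is
    spent only between white neighbours, whose probabilities of moving to [t2] differ by [eps]. *)
Lemma chain2_weak_bisimilar : weak_bisimilar eps (s2 : chain2) t2.
Proof.
have e0 := eps_gt0; have e1 := eps_lt.
exists near2; split=> //; split; [by case|by case=> -[]|].
move=> s t A st; split.
  by apply/(chain_label AP_nonempty); case: s st; case: t.
(* For equal states, reflexivity puts [A] inside its image and monotonicity suffices. *)
have [<-|sNt] := eqVneq s t.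
  apply: le_trans (_ : _ <= Pr_until s (same_label s) (rel_image near2 A)) _; last by lra.
  by apply: Pr_until_monotone => u Au; exists u => //; case: u {Au}.
(* A boolean implication, so that splitting on the memberships makes it compute and discards
   impossible combinations. *)
have image (u v : chain2) : near2 u v ->
    `[< A u >] ==> `[< rel_image near2 A v >].
  by move=> uv; apply/implyP => /asboolP Au; apply/asboolP; exists u.
case: s st sNt; case: t => // _ _;
  rewrite ?(@stepE s2) ?(@stepE t2) ?(@stepE x2) ?(@stepE y2) ?sinkE;
  rewrite ?(@stepE t2) ?chain_same_label //=.
- move: (image s2 t2 isT) (image x2 y2 isT) (image z2 y2 isT).
  by case_asbool; lra.
- move: (image t2 s2 isT) (image y2 x2 isT) (image y2 z2 isT).
  by case_asbool; lra.
- move: (image x2 y2 isT) (image t2 t2 isT) (image z2 y2 isT).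
  by case_asbool; lra.
- move: (image y2 x2 isT) (image t2 t2 isT) (image z2 z2 isT).
  by case_asbool; lra.
- move: (image y2 z2 isT) (image z2 z2 isT).
  by case_asbool; lra.
- move: (image z2 y2 isT).
  by case_asbool; lra.
Qed.

Lemma chain2_not_branching_bisimilar : ~ branching_bisimilar eps (s2 : chain2) t2.
Proof.
have e0 := eps_gt0; have e1 := eps_lt.
move=> [Rel [[[Rrefl Rsym Rtrans] bis] st]].
have colour x y : Rel x y -> black2 x = black2 y.
  move=> xy; apply/(chain_label AP_nonempty).
  (* Only the label clause is wanted here; the empty set is vacuously closed. *)
  by have [] := bis x y set0 xy; first by move=> ? [].
have colourF x y : black2 x != black2 y -> `[< eq_class Rel x y >] = false.
  by move=> xy; apply/asboolP => /colour/eqP; rewrite (negPf xy).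
have reflT x : `[< eq_class Rel x x >] by apply/asboolP; exact: Rrefl.
(* Into the class of [y2], [t2] moves surely, while [s2] gets there with probability at most 1/2 if
   [x2] or [z2] is missing from it; a gap of 1/2 exceeds [eps]. *)
have [y2x2 y2z2] : Rel y2 x2 /\ Rel y2 z2.
  have closed_y2 : rel_closed Rel (eq_class Rel y2).
    by move=> v [u y2u uv]; exact: Rtrans uv.
  have [_] := bis s2 t2 (eq_class Rel y2) st closed_y2.
  rewrite !(@stepE s2) !(@stepE t2) !(@stepE x2) !(@stepE y2) !sinkE.
  rewrite (colourF y2 s2) // (colourF y2 t2) // (colourF s2 x2) // (colourF t2 y2) //.
  rewrite !reflT /=.
  by case: asboolP => ?; case: asboolP => ? //=; rewrite ler_norml => /andP[]; lra.
have closed_black : rel_closed Rel [set u | black2 u].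
  by move=> v [u /= bu /colour]; rewrite bu => /= <-.
(* Transitivity through [y2] relates [x2] and [z2], which reach black with probabilities [2 * eps]
   and 0. *)
have [_] := bis x2 z2 _ (Rtrans _ _ _ (Rsym _ _ y2x2) y2z2) closed_black.
rewrite !(@stepE x2) !(@stepE t2) !sinkE.
have blackE u : `[< [set u | black2 u] u >] = black2 u by exact: asboolb.
rewrite reflT !blackE /=.
by rewrite ler_norml => /andP[]; lra.
Qed.

End WeakNotBranching.

Theorem proposition5p4 (R : realType) (AP : countType)
    (AP_nonempty : [set: AP] !=set0) (eps : R)
    (eps_gt0 : 0 < eps) (eps_lt : eps < 1 / 4) :
  (exists (M : LMC R AP) (s t : M),
     branching_bisimilar eps s t /\ ~ weak_bisimilar eps s t) /\
  (exists (M : LMC R AP) (s t : M),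
     weak_bisimilar eps s t /\ ~ branching_bisimilar eps s t).
Proof.
have eps_lt1 : eps < 1 by lra.
have eps_lt2 : eps < 1 / 2 by lra.
split.
  exists (chain1 eps_gt0 eps_lt1), s1, t1; split.
    exact: chain1_branching_bisimilar.
  exact: chain1_not_weak_bisimilar.
exists (chain2 eps_gt0 eps_lt2), s2, t2; split.
  exact: chain2_weak_bisimilar.
exact: chain2_not_branching_bisimilar.
Qed.
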